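(* Let $f:\mathbb{R}^n\to\bar{\mathbb{R}}$ and $g:\mathbb{R}^m\to\bar{\mathbb{R}}$ be lower semicontinuous proper convex functions, let $A\in\mathbb{R}^{m\times n}$ be a matrix, and let $T_a:=T_a(A\operatorname{dom}(f),\operatorname{dom}(g))$ be the affine joint supporting subspace. Then for every $x\in\mathbb{R}^n$, $$f(x)+g(Ax)=\big(f(x)+\iota_{A^{-1}(T_a)}(x)\big)+\big(g(Ax)+\iota_{T_a}(Ax)\big).$$ Moreover, whenever $\operatorname{dom}(f+g\circ A)\neq\emptyset$, $$A\,\operatorname{rint}\operatorname{dom}(f+\iota_{A^{-1}(T_a)})\ \cap\ \operatorname{rint}\operatorname{dom}(g+\iota_{T_a})\neq\emptyset.$$
   Context: $\bar{\mathbb{R}}=\mathbb{R}\cup\{-\infty,\infty\}$. For convex $f$, $\operatorname{dom}(f)=\{x: f(x)\neq\infty\}$; $f$ is proper if it is nowhere $-\infty$ and $\operatorname{dom}(f)\ne\emptyset$. $\operatorname{rint}$ is the relative interior. For a set $S$, $\iota_S$ is the indicator function, $0$ on $S$ and $\infty$ off $S$. A matrix $A$ is identified with its linear map; $AS$ is the image of $S$ and $A^{-1}(S)$ the preimage of $S$ (no invertibility assumed). $B\pm B'=\{b\pm b'\mid b\in B,b'\in B'\}$. Faces: for $C\subseteq\mathbb{R}^m$ convex, a subset $F\subseteq C$ is a face of $C$ if for all $y,z\in C$, whenever the open segment $]y,z[ = [y,z]\setminus\{y,z\}$ meets $F$, both $y,z\in F$. For $S\subseteq C$, $F_C(S)$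 denotes the smallest face of $C$ containing $S$; $F_C(x)=F_C(\{x\})$. Joint supporting subspace: for convex $C,D\subseteq\mathbb{R}^m$ with $C\cap D\neq\emptyset$, $T(C,D):=\operatorname{Span} F_{C-D}(0)$ (linear span) and $T_a(C,D):=T(C,D)+(C\cap D)$. If $C\cap D=\emptyset$, then $T_a(C,D)=\emptyset$. *)

(* Defs.v *)
From mathcomp Require Import all_boot all_order all_algebra.
From mathcomp Require Import all_classical all_reals all_analysis.

Set Implicit Arguments.
Unset Strict Implicit.
Unset Printing Implicit Defensive.

Import Order.TTheory GRing.Theory Num.Theory.
Import numFieldNormedType.Exports.

Local Open Scope classical_set_scope.
Local Open Scope ring_scope.

(* [R^k] is ['cV[R]_k], with the norm topology of the library. *)

Section sets.
Context {R : realType} {k : nat}.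
Implicit Types (y z : 'cV[R]_k) (B C D F S : set 'cV[R]_k).

Definition set_add B C : set 'cV[R]_k := [set b + c | b in B & c in C].

Definition set_sub B C : set 'cV[R]_k := [set b - c | b in B & c in C].

Definition linear_span S : set 'cV[R]_k :=
  smallest (fun L : set 'cV[R]_k => submod_closed (mem L)) S.

Definition affine_set (M : set 'cV[R]_k) : Prop :=
  forall y z (t : R), M y -> M z -> M (t *: y + (1 - t) *: z).

Definition affine_hull S : set 'cV[R]_k := smallest affine_set S.

Definition rint S : set 'cV[R]_k :=
  [set x | affine_hull S x /\ \forall y \near x, affine_hull S y -> S y].

Definition segment y z : set 'cV[R]_k :=
  [set t *: y + (1 - t) *: z | t in [set t : R | 0 <= t <= 1]].

(* Empty when [y = z]. *)
Definition open_segment y z : set 'cV[R]_k := segment y z `\` [set y; z].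

Definition face C F : Prop :=
  F `<=` C /\
  forall y z, C y -> C z -> open_segment y z `&` F !=set0 -> F y /\ F z.

(* Meaningful for [S `<=` C]: the faces of [C] are closed under intersections
   of nonempty families, so [smallest] is then attained. *)
Definition min_face C S : set 'cV[R]_k := smallest (face C) S.

(* Meaningful for [C `&` D !=set0], that is, when [0] is in [set_sub C D]. *)
Definition joint_supp C D : set 'cV[R]_k :=
  linear_span (min_face (set_sub C D) [set 0]).

(* A sum with the empty set is empty, so this is [set0] when
   [C `&` D = set0]. *)
Definition aff_joint_supp C D : set 'cV[R]_k :=
  set_add (joint_supp C D) (C `&` D).

End sets.

Section functions.
Context {R : realType} {k : nat}.
Implicit Types (f : 'cV[R]_k -> \bar R) (S : set 'cV[R]_k).

Definition epigraph f : set ('cV[R]_k * R^o) :=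
  [set p | (f p.1 <= p.2%:E)%E].

Definition convex_efun f : Prop := convex_set (epigraph f).

Definition edom f : set 'cV[R]_k := [set x | f x <> +oo%E].

Definition proper_efun f : Prop := (forall x, f x <> -oo%E) /\ edom f !=set0.

Definition iota_ind S : 'cV[R]_k -> \bar R :=
  fun x => if x \in S then 0%E else +oo%E.

End functions.

(* Main.v *)
Require Import Defs.
From mathcomp Require Import all_boot all_order all_algebra.
From mathcomp Require Import all_classical all_reals all_analysis.
From mathcomp Require Import ring lra.
Import Order.TTheory GRing.Theory Num.Theory.
Import numFieldNormedType.Exports.

(** Write [C] for the image under [A] of the domain of [f], [D] for the domain
    of [g], and [E = C - D]. The identity of functions holds because a point
    where [f x + g (A x)] is finite has [A x] in [C `&` D], which the affine
    joint supporting subspace [T_a] contains.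

    For the relative interiors, the key is an elementary description of the
    joint supporting subspace: when [C] and [D] meet, the span of the minimal
    face of [E] at [0] consists of the vectors [s] along which one can leave [0]
    in both directions while staying in [E] ([joint_suppE]). This subspace
    contains the difference of any two points of [C `&` D], so that [T_a] is an
    affine set directed by it.

    Now take relative interior points [x] of the first restricted domain and [y]
    of the second; they exist because nonempty convex sets in finite dimension
    have relative interior points ([rint_nonempty]). Since [A x - y] lies in [E]
    and in the joint supporting subspace, a negative multiple of it lies in [E]
    too. Hence there are [x'] and [y'] in the restricted domains such that the
    segments from [A x] to [A x'] and from [y] to [y'] meet, at the same
    parameter and away from [A x'] and [y'] ([aff_joint_supp_meet]). Points of a
    segment that starts at a relative interior point stay relatively interior
    except perhaps at the far end ([rint_segment]), so the meeting point is as
    required. *)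

Local Open Scope classical_set_scope.
Local Open Scope ring_scope.

(** * Convex and affine sets *)

Section convexity.
Set Implicit Arguments.
Unset Strict Implicit.
Context {R : realType} {k : nat}.
Implicit Types (x y z s p : 'cV[R]_k) (S E C D : set 'cV[R]_k).

(** Trades the bundled coefficients of the general convex spaces for inequalities
    on a real number. *)
Lemma convex_setP S :
  convex_set S <->
  forall y z (t : R), 0 <= t <= 1 -> S y -> S z -> S (t *: y + (1 - t) *: z).
Proof.
split=> [cS y z t /andP[t0 t1] Sy Sz|cS y z t].
  by have := cS y z (Itv01 t0 t1); rewrite !inE; apply.
by rewrite !inE => Sy Sz; apply: cS => //; apply/andP; split.
Qed.

Lemma affine_set_convex S : affine_set S -> convex_set S.
Proof. by move=> aS; apply/convex_setP => y z t _; apply: aS. Qed.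

Lemma convex_setI S E : convex_set S -> convex_set E -> convex_set (S `&` E).
Proof.
move=> /convex_setP cS /convex_setP cE; apply/convex_setP => y z t t01.
by move=> [? ?] [? ?]; split; [apply: cS|apply: cE].
Qed.

Lemma convex_set_sub C D :
  convex_set C -> convex_set D -> convex_set (set_sub C D).
Proof.
move=> /convex_setP cC /convex_setP cD; apply/convex_setP.
move=> _ _ t t01 [c Cc [d Dd <-]] [c' Cc' [d' Dd' <-]].
exists (t *: c + (1 - t) *: c'); first exact: cC.
exists (t *: d + (1 - t) *: d'); first exact: cD.
by apply/colP => i; rewrite !mxE; ring.
Qed.

Lemma convex_star S (t : R) x :
  convex_set S -> S 0 -> 0 <= t <= 1 -> S x -> S (t *: x).
Proof.
move=> /convex_setP cS S0 t01 Sx.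
by rewrite -[_ *: x]addr0 -(scaler0 _ (1 - t)); apply: cS.
Qed.

(** The leftover weight [1 - \sum_i c i] goes to [p]. Its being positive keeps
    [1 - c ord0] invertible, so that the induction can renormalize the remaining
    weights. *)
Lemma convex_pos_combination S p (r : nat)
    (v : 'I_r -> 'cV[R]_k) (c : 'I_r -> R) :
  convex_set S -> S p -> (forall i, S (p + v i)) -> (forall i, 0 <= c i) ->
  \sum_i c i < 1 -> S (p + \sum_i c i *: v i).
Proof.
move=> /convex_setP cS Sp; elim: r v c => [|r IH] v c Sv c0 c1.
  by rewrite big_ord0 addr0.
move: c1; rewrite !big_ord_recl => c1.
set c0' := c ord0 in c1 *.
have c0'0 : 0 <= c0' by exact: c0.
set sg := \sum_(i < r) c (lift ord0 i) in c1.
have sg0 : 0 <= sg by apply: sumr_ge0.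
have h1 : 0 < 1 - c0' by lra.
have := IH (fun i => v (lift ord0 i)) (fun i => (1 - c0')^-1 * c (lift ord0 i)).
rewrite -mulr_sumr -/sg => /(_ (fun i => Sv _)).
have cc i : 0 <= (1 - c0')^-1 * c (lift ord0 i).
  by rewrite mulr_ge0 // invr_ge0 ltW.
move=> /(_ cc); rewrite mulrC ltr_pdivrMr // mul1r.
have -> : sg < 1 - c0' by lra.
move=> /(_ isT) H.
have := cS _ _ c0' _ (Sv ord0) H.
have -> : 0 <= c0' <= 1 by apply/andP; split; lra.
move=> /(_ isT); congr S.
under eq_bigr do rewrite -scalerA.
rewrite -scaler_sumr [(1 - c0') *: _]scalerDr scalerA divff ?scale1r;
  last by rewrite gt_eqF.
by apply/colP => i; rewrite !mxE; ring.
Qed.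

End convexity.

(** * Relative interiors of convex sets *)

Section relative_interior.
Set Implicit Arguments.
Unset Strict Implicit.
Context {R : realType} {k : nat}.
Implicit Types (x y z s p : 'cV[R]_k) (S : set 'cV[R]_k).

Lemma affine_hull_affine S : affine_set (affine_hull S).
Proof.
move=> y z t Hy Hz M [aM SM].
by apply: (aM); [exact: (Hy M (conj aM SM))|exact: (Hz M (conj aM SM))].
Qed.

Lemma rint_sub S : rint S `<=` S.
Proof. by move=> x [aSx /nbhs_singleton]; apply. Qed.

(** The homothety of centre [s] and ratio [t^-1] is continuous, sends the new
    point back to [x] and preserves the affine hull; a point near the new one is
    thus a convex combination of [s] and of a point near [x]. *)
Lemma rint_segment S x s (t : R) : convex_set S -> rint S x -> S s ->
  0 < t <= 1 -> rint S (t *: x + (1 - t) *: s).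
Proof.
move=> /convex_setP cS [ax nx] Ss /andP[t0 t1].
have as_ : affine_hull S s by exact: sub_gen_smallest.
split; first exact: affine_hull_affine.
have tn : t != 0 by rewrite gt_eqF.
pose h (y : 'cV[R]_k) : 'cV[R]_k := t^-1 *: y + (1 - t^-1) *: s.
have hc z : h y @[y --> z] --> h z.
  have hz : t^-1 *: y @[y --> z] --> t^-1 *: z by exact: cvgZr cvg_id.
  exact: cvgD hz (cvg_cst _).
have hx : h (t *: x + (1 - t) *: s) = x.
  by apply/colP => i; rewrite !mxE; field.
have hK y : y = t *: h y + (1 - t) *: s.
  by apply/colP => i; rewrite !mxE; field.
have nh : \forall y \near t *: x + (1 - t) *: s,
    affine_hull S (h y) -> S (h y).
  by have := hc (t *: x + (1 - t) *: s); rewrite hx => /(_ _ nx).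
apply: filterS nh => y Hy ay.
rewrite [y]hK; apply: cS => //; first by rewrite ltW.
by apply: Hy; apply: affine_hull_affine.
Qed.

(** In coordinates, a linear form is a finite sum of multiples of entries. *)
Lemma linear_scalar_continuous (phi : {scalar 'cV[R]_k}) : continuous phi.
Proof.
have -> : phi = (fun y => \sum_i y i 0 * phi (delta_mx i 0)) :> (_ -> _).
  apply/funext => y; rewrite {1}(matrix_sum_delta y) linear_sum.
  by apply: eq_bigr => i _; rewrite big_ord1 linearZ.
apply: continuous_big => [|i _ y]; first exact: add_continuous.
exact: cvgM (@coord_continuous _ _ _ i 0 y) (cvg_cst _).
Qed.

(** When [p] is in [S], such an [X] is a basis of the direction space of
    [affine_hull S]. A free family of maximal size will do, since a direction
    outside its span could be added to it. *)
Lemma exists_frame S p :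
  exists r (X : r.-tuple 'cV[R]_k),
  [/\ free X, forall i : 'I_r, S (p + X`_i) &
      forall y, S y -> y - p \in <<X>>%VS].
Proof.
pose P r := `[< exists X : r.-tuple 'cV[R]_k,
  free X /\ forall i : 'I_r, S (p + X`_i) >].
have P0 : exists r, P r.
  exists 0%N; apply/asboolP; exists [tuple]; split; last by case.
  by rewrite /= nil_free.
have Pb r : P r -> (r <= \dim (@fullv _ 'cV[R]_k))%N.
  move=> /asboolP[X [fX _]].
  by move: fX; rewrite /free size_tuple => /eqP <-; exact/dimvS/subvf.
case: (ex_maxnP P0 Pb) => r /asboolP[X [fX SX]] rmax.
exists r, X; split=> // y Sy; apply: contrapT => /negP yX.
suff : P r.+1 by move=> /rmax; rewrite ltnn.
apply/asboolP; exists [tuple of (y - p) :: X]; split.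
  by rewrite /= free_cons yX.
move=> i; case: (unliftP ord0 i) => [j ->|->] /=; first exact: SX.
by rewrite addrC subrK.
Qed.

(** The barycentre of the simplex on [p] and a frame at [p]: all its barycentric
    coordinates are positive, they are continuous, and a point of the affine hull
    with positive coordinates belongs to the simplex. *)
Lemma rint_nonempty S : convex_set S -> S !=set0 -> rint S !=set0.
Proof.
move=> cS [p Sp].
have [r [X [fX SX spanX]]] := exists_frame S p.
(* The common weight of the [r + 1] vertices of the simplex. *)
pose q : R := r.+1%:R^-1.
have q0 : 0 < q by rewrite invr_gt0 ltr0n.
have rq : r%:R * q < 1 by rewrite ltr_pdivrMr ?ltr0n // mul1r ltr_nat.
pose x0 : 'cV[R]_k := p + \sum_(i < r) q *: X`_i.
have coord0 (i : 'I_r) : coord X i (x0 - p) = q.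
  by rewrite addrC addKr coord_sum_free.
have Scoord y : y - p \in <<X>>%VS -> (forall i : 'I_r, 0 < coord X i (y - p)) ->
    \sum_i coord X i (y - p) < 1 -> S y.
  move=> yX c0 c1; rewrite -[y](subrKC p) (coord_span yX).
  by apply: convex_pos_combination => // i; exact: ltW.
have hullX y : affine_hull S y -> y - p \in <<X>>%VS.
  move: y; apply: smallest_sub => // y z t yX zX.
  have -> : t *: y + (1 - t) *: z - p = t *: (y - p) + (1 - t) *: (z - p).
    by apply/colP => i; rewrite !mxE; ring.
  by rewrite memvD // memvZ.
have sum0 : \sum_(i < r) coord X i (x0 - p) < 1.
  by rewrite (eq_bigr (fun=> q)) // sumr_const card_ord -[q *+ _]mulr_natl.
have x0X : x0 - p \in <<X>>%VS.
  rewrite addrC addKr; apply: memv_suml => i _; apply/memvZ/memv_span.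
  by rewrite mem_nth // size_tuple.
have Sx0 : S x0 by apply: Scoord => // i; rewrite coord0.
have cvgc (i : 'I_r) : coord X i (y - p) @[y --> x0] --> coord X i (x0 - p).
  apply: (@continuous_comp _ _ _ (fun y => y - p) (coord X i)).
    exact: cvgB cvg_id (cvg_cst _).
  exact: linear_scalar_continuous.
have npos : \forall y \near x0, forall i : 'I_r, 0 < coord X i (y - p).
  have pos (i : 'I_r) : \forall y \near x0, 0 < coord X i (y - p).
    by apply: (cvgr_gt _ (cvgc i)); rewrite coord0.
  exact: (filter_forall _ pos).
have nsum : \forall y \near x0, \sum_i coord X i (y - p) < 1.
  have cvgs : \sum_i coord X i (y - p) @[y --> x0] -->
      \sum_i coord X i (x0 - p).
    exact: (cvg_big add_continuous _ (fun i _ => cvgc i)).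
  exact: (cvgr_lt _ cvgs).
exists x0; split; first exact: sub_gen_smallest.
by near=> y => /hullX yX; apply: Scoord => //; near: y.
Unshelve. all: by end_near. Qed.

End relative_interior.

(** * The joint supporting subspace *)

Section joint_support.
Set Implicit Arguments.
Unset Strict Implicit.
Context {R : realType} {k : nat}.
Implicit Types (x y z s p : 'cV[R]_k) (E C D : set 'cV[R]_k).

(** For a convex [E] containing [0], this is the span of the smallest face of [E]
    that contains [0]. *)
Definition two_way E : set 'cV[R]_k :=
  [set s | exists2 e : R, 0 < e & E (e *: s) /\ E (- e *: s)].

Lemma two_way_submod E :
  convex_set E -> E 0 -> submod_closed (mem (two_way E)).
Proof.
move=> cE E0.
have shrink (e e' : R) s : 0 <= e <= e' -> E (e' *: s) -> E (e *: s).
  move=> /andP[e0 ee'] Es; have [e'0|e'0] := eqVneq e' 0.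
    have -> : e = 0 by lra.
    by rewrite scale0r.
  have e'p : 0 < e' by rewrite lt_def e'0 (le_trans e0 ee').
  rewrite -[e](divfK e'0) -scalerA; apply: convex_star => //.
  by rewrite divr_ge0 ?(ltW e'p) //= ler_pdivrMr // mul1r.
have twZ (a : R) s : two_way E s -> two_way E (a *: s).
  move=> [e e0 [Es ENs]].
  have [a0|a0|->] := ltrgt0P a; last first.
  - by exists 1; rewrite // scale0r !scaler0.
  - exists (e / - a); first by rewrite divr_gt0 // oppr_gt0.
    rewrite !scalerA.
    have -> : e / - a * a = - e by field; lra.
    by have -> : - (e / - a) * a = e by field; lra.
  - exists (e / a); first by rewrite divr_gt0.
    rewrite !scalerA mulNr divfK //; lra.
split; first by rewrite inE/=; exists 1; rewrite // !scaler0.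
move=> a u v; rewrite !inE/= => /(twZ a) [e e0 [Eu ENu]] [d d0 [Ev ENv]].
set m := Num.min e d.
have m0 : 0 < m by rewrite lt_min e0.
have me : 0 <= m <= e by rewrite ltW //= ge_min lexx.
have md : 0 <= m <= d by rewrite ltW //= ge_min lexx orbT.
have half (w w' : 'cV[R]_k) :
    E (m *: w) -> E (m *: w') -> E ((m / 2) *: (w + w')).
  move=> Ew Ew'; have /convex_setP cE' := cE.
  have := cE' _ _ (1 / 2) _ Ew Ew'.
  have -> : 0 <= (1 / 2 : R) <= 1 by apply/andP; split; lra.
  by move=> /(_ isT); congr E; apply/colP => i; rewrite !mxE; field.
exists (m / 2); first by rewrite divr_gt0.
split; first by apply: half; [exact: shrink Eu|exact: shrink Ev].
rewrite scaleNr -scalerN opprD; apply: half.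
  by apply: shrink me _; rewrite scalerN -scaleNr.
by apply: shrink md _; rewrite scalerN -scaleNr.
Qed.

(** Inside [E] the two directions may use different step sizes: shrink both to a
    common one. *)
Lemma two_way_mem E s (e : R) : convex_set E -> E 0 -> E s -> 0 < e ->
  E (- e *: s) -> two_way E s.
Proof.
move=> cE E0 Es e0 ENs.
have e1 : 0 < 1 + e by lra.
exists (e / (1 + e)); first by rewrite divr_gt0.
have -> : - (e / (1 + e)) *: s = (1 + e)^-1 *: (- e *: s).
  by rewrite scalerA; congr (_ *: _); ring.
split; apply: convex_star => //.
  by rewrite divr_ge0 ?(ltW e0) ?(ltW e1) //= ler_pdivrMr // mul1r; lra.
by rewrite invr_ge0 (ltW e1) /= invf_le1 //; lra.
Qed.

(** If [q] is interior to the segment from [y] to [z] and [- e *: q] is in [E],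
    the segment from [- e *: q] to [z] crosses the line through [0] and [y] on
    the other side of [0]; so [y] can be followed backwards from [0], and [z]
    too by symmetry. *)
Lemma face_two_way E : convex_set E -> E 0 -> face E (E `&` two_way E).
Proof.
move=> cE E0; split=> [x []//|y z Ey Ez].
have /convex_setP cE' := cE.
have back y' z' (t e : R) : E y' -> E z' -> 0 < t < 1 -> 0 < e ->
    E (- e *: (t *: y' + (1 - t) *: z')) -> two_way E y'.
  move=> Ey' Ez' /andP[t0 t1] e0 Eq.
  have d0 : 0 < 1 + e * (1 - t) by rewrite addr_gt0 // mulr_gt0 // subr_gt0.
  (* The weight that cancels the [z'] component. *)
  pose a := (1 + e * (1 - t))^-1.
  have a0 : 0 < a by rewrite invr_gt0.
  have a1 : a <= 1 by rewrite invf_le1 // lerDl mulr_ge0 ?subr_ge0 // ltW.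
  apply: (@two_way_mem _ _ (a * e * t)) => //; first by rewrite !mulr_gt0.
  have := cE' _ _ a _ Eq Ez'; rewrite (ltW a0) a1 => /(_ isT); congr E.
  by apply/colP => i; rewrite !mxE /a; field; lra.
move=> [_ [[[t /= /andP[t0 t1] <-] Nyz] [_ [e e0 [_ ENq]]]]].
have t0' : t != 0.
  apply: contra_notN Nyz => /eqP ->; right.
  by rewrite /= subr0 scale0r scale1r add0r.
have t1' : t != 1.
  apply: contra_notN Nyz => /eqP ->; left.
  by rewrite /= subrr scale0r scale1r addr0.
have t0p : 0 < t by rewrite lt_def t0'.
have t1p : t < 1 by rewrite lt_neqAle t1'.
split; split => //.
  by apply: (back y z t e) => //; rewrite t0p.
apply: (back z y (1 - t) e) => //; first by apply/andP; split; lra.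
by move: ENq; congr E; apply/colP => i; rewrite !mxE; ring.
Qed.

(** A face containing [0] contains both ends of any segment of [E] that has [0]
    in its interior. *)
Lemma two_way_sub_min_face E : E `&` two_way E `<=` min_face E [set 0].
Proof.
move=> s [Es [e e0 [_ ENs]]] F [[FE faceF] F0].
have [->|s0] := eqVneq s 0; first exact: F0.
have e1 : 1 + e != 0 by rewrite gt_eqF // addr_gt0.
(* The open segment requires distinct end points, hence [s != 0]. *)
suff : open_segment s (- e *: s) `&` F !=set0 by move=> /(faceF _ _ Es ENs)[].
exists 0; split; last exact: F0.
split.
  exists (e / (1 + e)) => /=.
    rewrite divr_ge0 ?addr_ge0 ?(ltW e0) //=.
    by rewrite ler_pdivrMr ?addr_gt0 // mul1r; lra.
  by apply/colP => i; rewrite !mxE; field.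
move=> [/=/esym/eqP|/esym/eqP]; first by rewrite (negbTE s0).
by rewrite scaler_eq0 oppr_eq0 (negbTE s0) gt_eqF.
Qed.

Lemma linear_span_submod E : submod_closed (mem (linear_span E)).
Proof.
split=> [|a u v]; rewrite !inE.
  by move=> M [cM _]; have := cM.1; rewrite inE.
by move=> Hu Hv M [cM EM]; have := cM.2 a u v; rewrite !inE => cM2; apply: cM2;
    [exact: (Hu M (conj cM EM))|exact: (Hv M (conj cM EM))].
Qed.

Lemma linear_spanP E (a : R) u v :
  linear_span E u -> linear_span E v -> linear_span E (a *: u + v).
Proof. by have := (linear_span_submod E).2 a u v; rewrite !inE. Qed.

Lemma linear_span0 E : linear_span E 0.
Proof. by have := (linear_span_submod E).1; rewrite inE. Qed.

(** With [E = C - D], which is convex and contains [0], [two_way E] is a subspace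
    whose trace on [E] is a face; conversely, a positive multiple of each of its
    vectors lies in the minimal face at [0]. *)
Lemma joint_suppE C D : convex_set C -> convex_set D -> C `&` D !=set0 ->
  joint_supp C D = two_way (set_sub C D).
Proof.
move=> cC cD [p [Cp Dp]].
have cE := convex_set_sub cC cD.
have E0 : set_sub C D 0 by exists p => //; exists p => //; rewrite subrr.
apply/seteqP; split.
  apply: smallest_sub; first exact: two_way_submod.
  apply: subset_trans (@subIsetr _ (set_sub C D) _).
  apply: smallest_sub; first exact: face_two_way.
  by move=> _ ->; split=> //; exists 1; rewrite // !scaler0.
move=> s [e e0 [Es ENs]].
(* [s] may lie outside [E], but [e *: s] is in the minimal face. *)
have <- : e^-1 *: (e *: s) = s by rewrite scalerA mulVf ?scale1r // gt_eqF.
rewrite -[_ *: _]addr0; apply: linear_spanP; last first.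
  exact: linear_span0.
apply: sub_gen_smallest; apply: two_way_sub_min_face; split=> //.
by exists 1; rewrite // scaleN1r -scaleNr scale1r.
Qed.

Lemma joint_supp_sub C D : convex_set C -> convex_set D ->
  forall p q, (C `&` D) p -> (C `&` D) q -> joint_supp C D (p - q).
Proof.
move=> cC cD p q [Cp Dp] [Cq Dq]; rewrite joint_suppE //; last by exists p.
exists 1 => //; rewrite scaleN1r scale1r opprB.
by split; [exists p => //; exists q|exists q => //; exists p].
Qed.

Lemma aff_joint_supp_affine C D : convex_set C -> convex_set D ->
  affine_set (aff_joint_supp C D).
Proof.
move=> cC cD _ _ t [u Tu [p CDp <-]] [v Tv [q CDq <-]].
have Tqp := joint_supp_sub cC cD CDq CDp.
exists (t *: u + ((1 - t) *: v + ((1 - t) *: (q - p) + 0))).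
  do 3!apply: linear_spanP => //.
  exact: linear_span0.
by exists p => //; apply/colP => i; rewrite !mxE; ring.
Qed.

Lemma aff_joint_supp_sub C D : convex_set C -> convex_set D ->
  forall y z, aff_joint_supp C D y -> aff_joint_supp C D z ->
  joint_supp C D (y - z).
Proof.
move=> cC cD _ _ [u Tu [p CDp <-]] [v Tv [q CDq <-]].
have Tpq := joint_supp_sub cC cD CDp CDq.
have -> : u + p - (v + q) = -1 *: v + (1 *: u + (p - q)).
  by apply/colP => i; rewrite !mxE; ring.
by do 2!apply: linear_spanP => //.
Qed.

Lemma setI_sub_aff_joint_supp C D : C `&` D `<=` aff_joint_supp C D.
Proof.
move=> p CDp; exists 0; last by exists p; rewrite // add0r.
exact: linear_span0.
Qed.

(** The difference [c - d] lies in [C - D] and in the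
    joint supporting subspace, so a negative multiple of it is again a difference
    [c' - d']: the segments from [c] to [c'] and from [d] to [d'] then share a
    point, which lies in [C] and in [D], hence in the affine set. That point and
    [c] (respectively [d]) put [c'] (respectively [d']) in the affine set too. *)
Lemma aff_joint_supp_meet C D c d :
  convex_set C -> convex_set D -> C `&` D !=set0 ->
  (C `&` aff_joint_supp C D) c -> (D `&` aff_joint_supp C D) d ->
  exists2 t : R, 0 < t <= 1 & exists c' d',
    [/\ (C `&` aff_joint_supp C D) c', (D `&` aff_joint_supp C D) d' &
        t *: c + (1 - t) *: c' = t *: d + (1 - t) *: d'].
Proof.
move=> cC cD CD [Cc Tc] [Dd Td].
have := aff_joint_supp_sub cC cD Tc Td; rewrite joint_suppE //.
move=> [e e0 [_ [c' Cc' [d' Dd' cd']]]].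
have e1 : 0 < 1 + e by rewrite addr_gt0.
have e1n : 1 + e != 0 by rewrite gt_eqF.
pose t := e / (1 + e).
have t0 : 0 < t by rewrite divr_gt0.
have t1 : t <= 1 by rewrite ler_pdivrMr // mul1r; lra.
have t01 : 0 <= t <= 1 by rewrite ltW.
have meet : t *: c + (1 - t) *: c' = t *: d + (1 - t) *: d'.
  rewrite -[c'](subrK d') cd'.
  by apply/colP => i; rewrite !mxE /t; field.
set p := t *: c + (1 - t) *: c' in meet.
have Tp : aff_joint_supp C D p.
  apply: setI_sub_aff_joint_supp; split.
    by move/convex_setP : cC; apply.
  by rewrite meet; move/convex_setP : cD; apply.
have aT := aff_joint_supp_affine cC cD.
exists t; first by rewrite t0.
exists c', d'; split => //; split => //.
  have -> : c' = (1 + e) *: p + (1 - (1 + e)) *: c.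
    by apply/colP => i; rewrite !mxE /t; field.
  exact: aT.
have -> : d' = (1 + e) *: p + (1 - (1 + e)) *: d.
  by rewrite meet; apply/colP => i; rewrite !mxE /t; field.
exact: aT.
Qed.

End joint_support.

(** * Effective domains and linear images *)

Section effective_domain.
Set Implicit Arguments.
Unset Strict Implicit.
Context {R : realType} {k : nat}.
Implicit Types (f : 'cV[R]_k -> \bar R) (S : set 'cV[R]_k).

Lemma edom_convex f : proper_efun f -> convex_efun f -> convex_set (edom f).
Proof.
move=> [fN _] cf; apply/convex_setP => y z t /andP[t0 t1] fy fz.
have fin u : edom f u -> exists r : R, f u = r%:E.
  by have := fN u; rewrite /edom/=; case: (f u) => // r _ _; exists r.
have [[a fa] [b fb]] := (fin _ fy, fin _ fz).
have := cf (y, a) (z, b) (Itv01 t0 t1).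
rewrite !inE /epigraph/= fa fb => /(_ (lexx _) (lexx _)) H fi.
by move: H; rewrite [X in (X <= _)%E]fi.
Qed.

Lemma edom_iota_ind f S : (forall x, f x <> -oo%E) ->
  edom (fun x => f x + iota_ind S x)%E = edom f `&` S.
Proof.
move=> fN; apply/seteqP; split=> x; rewrite /edom /iota_ind /=.
  case: ifPn => [/set_mem Sx|_]; first by rewrite adde0.
  by have := fN x; case: (f x).
by move=> [fx Sx]; rewrite mem_set // adde0.
Qed.

End effective_domain.

Section linear_images.
Set Implicit Arguments.
Unset Strict Implicit.
Context {R : realType} {m n : nat}.
Implicit Types (A : 'M[R]_(m, n)).

Lemma convex_set_image A (S : set 'cV[R]_n) :
  convex_set S -> convex_set (mulmx A @` S).
Proof.
move=> /convex_setP cS; apply/convex_setP => _ _ t t01 [x Sx <-] [y Sy <-].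
exists (t *: x + (1 - t) *: y); first exact: cS.
by rewrite mulmxDr -!scalemxAr.
Qed.

Lemma convex_set_preimage A (S : set 'cV[R]_m) :
  convex_set S -> convex_set (mulmx A @^-1` S).
Proof.
move=> /convex_setP cS; apply/convex_setP => x y t t01 Sx Sy.
by rewrite /preimage/= mulmxDr -!scalemxAr; exact: cS.
Qed.

End linear_images.

(** * Nondegenerate intersection of the restricted domains *)

Theorem theorem5p1 (R : realType) (n m : nat)
    (f : 'cV[R]_n -> \bar R) (g : 'cV[R]_m -> \bar R) (A : 'M[R]_(m, n))
    (f_lsc : lower_semicontinuous f) (f_proper : proper_efun f)
    (f_convex : convex_efun f)
    (g_lsc : lower_semicontinuous g) (g_proper : proper_efun g)
    (g_convex : convex_efun g) :
  let T_a := aff_joint_supp (mulmx A @` edom f) (edom g) in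
  (forall x : 'cV[R]_n,
     (f x + g (A *m x) =
      (f x + iota_ind (mulmx A @^-1` T_a) x)
      + (g (A *m x) + iota_ind T_a (A *m x)))%E) /\
  (edom (fun x : 'cV[R]_n => (f x + g (A *m x))%E) !=set0 ->
   (mulmx A @`
      rint (edom (fun x : 'cV[R]_n =>
                    (f x + iota_ind (mulmx A @^-1` T_a) x)%E)))
   `&` rint (edom (fun y : 'cV[R]_m => (g y + iota_ind T_a y)%E)) !=set0).
Proof.
move=> T_a; have [fN _] := f_proper; have [gN _] := g_proper.
have memT x : f x <> +oo%E -> g (A *m x) <> +oo%E -> T_a (A *m x).
  by move=> fx gx; apply: setI_sub_aff_joint_supp; split=> //; exists x.
split=> [x|[x0 dx0]].
  rewrite /iota_ind (_ : (x \in mulmx A @^-1` T_a) = (A *m x \in T_a)) //.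
  case: ifPn => [_|/negP NT]; first by rewrite !adde0.
  have {}NT : ~ (f x <> +oo%E /\ g (A *m x) <> +oo%E).
    by move=> [fx gx]; apply/NT/mem_set/memT.
  move: (fN x) (gN (A *m x)) NT; case: (f x) => [a||]; case: (g _) => [b||] //=.
  by move=> _ _ [].
have cC := convex_set_image (A := A) (edom_convex f_proper f_convex).
have cD := edom_convex g_proper g_convex.
have aT : affine_set T_a by exact: aff_joint_supp_affine.
have cT := affine_set_convex aT.
rewrite !edom_iota_ind //.
set X' := edom f `&` _; set D' := edom g `&` T_a.
have cX' : convex_set X'.
  by apply: convex_setI; [exact: edom_convex|exact: convex_set_preimage].
have cD' : convex_set D' by exact: convex_setI.
have [fx0 gx0] : f x0 <> +oo%E /\ g (A *m x0) <> +oo%E.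
  move: dx0 (fN x0) (gN (A *m x0)); rewrite /edom/=.
  by case: (f x0) => [?||]; case: (g _).
have Tx0 := memT _ fx0 gx0.
have [x rx] : rint X' !=set0 by apply: rint_nonempty => //; exists x0.
have [y ry] : rint D' !=set0 by apply: rint_nonempty => //; exists (A *m x0).
have [fx Tx] := rint_sub rx.
have [||t t01] := aff_joint_supp_meet (c := A *m x) cC cD _ _ (rint_sub ry).
- by exists (A *m x0); split=> //; exists x0.
- by split; [exists x|exact: Tx].
move=> [_ [y' [[[x' fx' <-] Tx'] Dy' xy]]].
exists (A *m (t *: x + (1 - t) *: x')); split.
  by exists (t *: x + (1 - t) *: x') => //; exact: rint_segment.
by rewrite mulmxDr -!scalemxAr xy; exact: rint_segment.
Qed.
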